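(* Let $d,k\ge 2$, let $G$ be a $(d,k;+1)$-digraph and let $\phi$ be a non-identity automorphism of $G$. Let $\mathrm{FIX}(\phi)$ be the subdigraph of $G$ induced by the set of vertices fixed by $\phi$. Then $\mathrm{FIX}(\phi)$ is either the null digraph (no vertices), a pair of isolated vertices, a directed $(k+2)$-cycle, or a $(d',k;+1)$-digraph for some $d'$ with $3\le d'\le d-1$.
   Context: Digraphs are finite and without multiple arcs. A digraph $G$ is $k$-geodetic if for any (not necessarily distinct) vertices $u,v$ there is at most one directed walk from $u$ to $v$ of length at most $k$ (walks of length $0$ count, so there are no directed cycles of length at most $k$). Put $M(d,k)=1+d+d^2+\dots+d^k$. A $(d,k;+1)$-digraph is a $k$-geodetic digraph with minimum out-degree $d$ and order $M(d,k)+1$. In such a digraph (with $d,k\ge 2$), for every vertex $u$ there is a unique vertex $o(u)$ with $d(u,o(u))\ge k+1$; $o$ is the outlier function. It is known that such $G$ is diregular, that $o$ is an automorphism of $G$, and that there are no $(2,k;+1)$-digraphs for $k\ge 2$. *)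

(* Defs.v *)
From mathcomp Require Import all_boot all_fingroup.

Set Implicit Arguments.
Unset Strict Implicit.
Unset Printing Implicit Defensive.

(* Finite digraphs without multiple arcs.  Loops are not excluded by the type,
   but k-geodeticity with k >= 1 rules them out. *)
Record digraph := Digraph { vertex :> finType; arc : rel vertex }.

Definition diso (G H : digraph) : Prop :=
  exists f : G -> H, bijective f /\ forall x y, arc (f x) (f y) = arc x y.

Definition induced (G : digraph) (A : {set G}) : digraph :=
  @Digraph {x : G | x \in A} (fun x y => arc (val x) (val y)).

Definition dicycle (n : nat) : digraph :=
  @Digraph 'I_n (fun i j => j == ordS i).

(* A walk from u is the sequence p of its vertices after u; its length is
   size p (possibly 0) and its end is last u p.  Without multiple arcs a walk
   is determined by its vertices. *)
Definition diwalk (G : digraph) (u : G) (p : seq G) (v : G) : bool :=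
  path (@arc G) u p && (last u p == v).

Definition geodetic (k : nat) (G : digraph) : Prop :=
  forall (u v : G) (p q : seq G),
    diwalk u p v -> size p <= k -> diwalk u q v -> size q <= k -> p = q.

Definition outdeg (G : digraph) (u : G) : nat := #|[set v | arc u v]|.

Definition min_outdeg (G : digraph) (d : nat) : Prop :=
  (exists u : G, outdeg u = d) /\ (forall u : G, d <= outdeg u).

Definition moore (d k : nat) : nat := \sum_(i < k.+1) d ^ i.

(* The (d,k;+1)-digraphs: order one more than the Moore bound. *)
Definition excess_one (d k : nat) (G : digraph) : Prop :=
  [/\ geodetic k G, min_outdeg G d & #|G| = moore d k + 1].

Definition automorphism (G : digraph) (phi : {perm G}) : Prop :=
  forall x y : G, arc (phi x) (phi y) = arc x y.

Definition FIX (G : digraph) (phi : {perm G}) : digraph :=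
  induced [set x : G | phi x == x].

Definition null_digraph (G : digraph) : Prop := #|G| = 0.

Definition two_isolated (G : digraph) : Prop :=
  #|G| = 2 /\ forall x y : G, ~~ arc x y.

(* Main.v *)
(* A unique short walk between two fixed vertices is fixed, so the fixed
   subdigraph F inherits k-geodeticity and the outlier function o.  Counting
   walks of length 1 .. k+1 from u to v by their first or by their last arc gives
     outdeg u + [o u -> v] = indeg v + #{w | u -> w, o w = v}.
   Where o is an automorphism this says outdeg u = indeg v for all u and v, so F
   is diregular of some degree d', of order M(d',k) + 1.  Degree 0 gives two
   isolated vertices, degree 1 a (k+2)-cycle, and degree 2 is impossible.

   That o is an automorphism of G follows from the same identity once G is
   diregular.  If G were not, o would take only two values, and merging these two
   vertices would produce a digraph of order exactly M(d,k) with a unique walk of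
   length at most k between any two vertices; a trace argument excludes this.

   In degree 2, two vertices u -> x, y and v -> x, z sharing an out-neighbour
   satisfy either o u = v, y = z and o x = y, or o u = z and o v = y; either
   pattern, propagated one step, yields two walks of length 2 with the same ends. *)
Require Import Defs.
From mathcomp Require Import all_boot all_fingroup all_algebra.
From mathcomp Require Import zify ring.
Import Defs.

Set Implicit Arguments.
Unset Strict Implicit.
Unset Printing Implicit Defensive.

(** * Traces of matrices of finite order *)

Section FiniteOrderTrace.
Import GRing.Theory Num.Theory.
Local Open Scope ring_scope.
Variables (n k : nat).
Implicit Type B : 'M[rat]_n.

(* [B] is an isometry of the averaged form [Q], so its inverse [B ^+ k] is
   conjugate to its transpose. *)
Lemma mxtrace_finite_order B : B ^+ k.+1 = 1 -> \tr (B ^+ k) = \tr B.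
Proof.
move=> Bk1.
pose Q := \sum_(i < k.+1) B ^+ i *m (B ^+ i)^T.
have BQB : B *m Q *m B^T = Q.
  rewrite mulmx_sumr mulmx_suml big_ord_recr /= [RHS]big_ord_recl addrC /=.
  congr (_ + _); last first.
    apply: eq_bigr => i _.
    by rewrite exprS trmx_mul !mulmxA.
  have BBk : B *m B ^+ k = 1 by rewrite -[_ *m _]exprS.
  by rewrite -!mulmxA -trmx_mul !mulmxA BBk expr0.
(* [Q] is positive definite: a diagonal entry of [K *m Q *m K^T] is a sum of squares whose part at
   exponent 0 is the squared norm of a row of [K]. *)
have Qfree : row_free Q.
  rewrite -kermx_eq0; set K := kermx Q; apply/eqP/matrixP => i j.
  have : K *m Q *m K^T = 0 by rewrite mulmx_ker mul0mx.
  rewrite mulmx_sumr mulmx_suml => /matrixP/(_ i i)/eqP.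
  rewrite summxE mxE psumr_eq0 => [/allP/(_ ord0)|l _].
    rewrite mem_index_enum expr0 trmx1 !mulmx1 => /(_ isT).
    rewrite /= mxE psumr_eq0 => [/allP/(_ j)|l _]; last first.
      by rewrite [X in _ * X]mxE -expr2 sqr_ge0.
    by rewrite mem_index_enum [X in _ * X]mxE [RHS]mxE /= mulf_eq0 orbb => /(_ isT)/eqP.
  rewrite !mulmxA -mulmxA -trmx_mul mxE; apply: sumr_ge0 => j' _.
  by rewrite [X in _ * X]mxE -expr2 sqr_ge0.
have uQ : Q \in unitmx by rewrite -row_free_unit.
have BkB : B ^+ k *m B = 1 by rewrite -[_ *m _]exprSr.
have BtE : B^T = invmx Q *m B ^+ k *m Q.
  apply: (can_inj (mulKmx uQ)); rewrite !mulmxA mulmxV // mul1mx.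
  by rewrite -[in RHS]BQB !mulmxA BkB mul1mx.
by rewrite -[RHS]mxtrace_tr BtE mxtrace_mulC mulmxA mulmxV // mul1mx.
Qed.

End FiniteOrderTrace.

(** * Counting walks with multiplicities *)

Section WeightedWalks.
Variables (T : finType) (f : T -> T -> nat).

(** Arcs carry natural multiplicities because the merged digraph in [in_regular] could a priori have
    parallel arcs. *)
Fixpoint nwalks i u v : nat :=
  if i is j.+1 then \sum_w f u w * nwalks j w v else (u == v).

Definition nball k u v := \sum_(i < k.+1) nwalks i u v.

Lemma nwalks0 u v : nwalks 0 u v = (u == v).
Proof. by []. Qed.

Lemma nwalksS i u v : nwalks i.+1 u v = \sum_w f u w * nwalks i w v.
Proof. by []. Qed.

Lemma nwalks1 u v : nwalks 1 u v = f u v.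
Proof.
rewrite /= (bigD1 v) //= eqxx muln1 big1 ?addn0 // => w /negbTE->.
by rewrite muln0.
Qed.

Lemma nwalksSr i u v : nwalks i.+1 u v = \sum_w nwalks i u w * f w v.
Proof.
elim: i u v => [|i IHi] u v.
  rewrite nwalks1 (bigD1 u) //= eqxx mul1n big1 ?addn0 // => w.
  by rewrite eq_sym => /negbTE->.
rewrite nwalksS; under eq_bigr do rewrite IHi big_distrr.
rewrite exchange_big; apply: eq_bigr => w _; rewrite nwalksS big_distrl.
by apply: eq_bigr => w' _; exact: mulnA.
Qed.

Lemma nwalks_length k u v i j : nball k u v <= 1 -> i <= k -> j <= k ->
  0 < nwalks i u v -> 0 < nwalks j u v -> i = j.
Proof.
move=> uv1 ik jk i_walk j_walk; apply/eqP; apply: contraTT uv1 => ij.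
rewrite /nball (bigD1 (Ordinal (ik : i < k.+1))) //=.
rewrite (bigD1 (Ordinal (jk : j < k.+1))) /=; last by rewrite -val_eqE eq_sym.
by rewrite -ltnNge addnA (leq_trans _ (leq_addr _ _)) // (leq_add i_walk).
Qed.

Lemma nballS k u v : nball k.+1 u v = (u == v) + \sum_w f u w * nball k w v.
Proof.
rewrite /nball big_ord_recl; congr (_ + _).
under [RHS]eq_bigr do rewrite big_distrr.
by rewrite exchange_big.
Qed.

Lemma nball_comm k u v :
  \sum_w f u w * nball k w v = \sum_w nball k u w * f w v.
Proof.
under eq_bigr do rewrite big_distrr.
rewrite exchange_big; under [RHS]eq_bigr do rewrite big_distrl.
rewrite [RHS]exchange_big; apply: eq_bigr => i _.
by rewrite -nwalksSr.
Qed.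

Lemma sum_nwalks d i u : (forall x, \sum_y f x y = d) -> \sum_v nwalks i u v = d ^ i.
Proof.
move=> fd; elim: i u => [|i IHi] u /=.
  by rewrite (bigD1 u) //= eqxx big1 ?addn0 // => v; rewrite eq_sym => /negbTE->.
rewrite exchange_big expnS -{1}(fd u) big_distrl /=.
by apply: eq_bigr => w _; rewrite -big_distrr IHi.
Qed.

Lemma sum_nball d k u : (forall x, \sum_y f x y = d) -> \sum_v nball k u v = moore d k.
Proof.
by move=> fd; rewrite exchange_big; apply: eq_bigr => i _; rewrite (sum_nwalks _ _ fd).
Qed.

Lemma sum_nwalks_in d i v : (forall y, \sum_x f x y = d) -> \sum_u nwalks i u v = d ^ i.
Proof.
move=> fd; elim: i v => [|i IHi] v.
  by rewrite (bigD1 v) //= eqxx big1 ?addn0 // => u /negbTE->.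
under eq_bigr do rewrite nwalksSr.
rewrite exchange_big expnSr -{2}(fd v) big_distrr /=.
by apply: eq_bigr => w _; rewrite -big_distrl IHi.
Qed.

Lemma sum_nball_in d k v : (forall y, \sum_x f x y = d) -> \sum_u nball k u v = moore d k.
Proof.
by move=> fd; rewrite exchange_big; apply: eq_bigr => i _; rewrite (sum_nwalks_in _ _ fd).
Qed.

End WeightedWalks.

(** * Nonexistence of Moore digraphs *)

Section MooreDigraph.
Import GRing.Theory Num.Theory.
Local Open Scope ring_scope.
Variables (T : finType) (f : T -> T -> nat) (d k : nat).
Local Notation n := #|T|.

Let A : 'M[rat]_n := \matrix_(i, j) (f (enum_val i) (enum_val j))%:R.
Let J : 'M[rat]_n := const_mx 1.

Lemma adj_expE m i j : (A ^+ m) i j = (nwalks f m (enum_val i) (enum_val j))%:R.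
Proof.
elim: m i j => [|m IHm] i j; first by rewrite expr0 mxE /= (inj_eq enum_val_inj).
rewrite exprS mxE natr_sum [RHS]big_enum_val.
by apply: eq_bigr => l _; rewrite !mxE IHm natrM.
Qed.

(* Bridges--Toueg: all eigenvalues of [B := A - (d - 1) / n J] are [(k+1)]-st
   roots of unity, so [\tr B = 1 - d] and [\tr (B ^+ k) = 1 - d ^ k] are
   complex conjugates. *)
Lemma no_moore_digraph (x0 : T) : (2 <= d)%N -> (2 <= k)%N ->
  (forall x, \sum_y f x y = d)%N -> (forall x y, nball f k x y = 1%N) -> False.
Proof.
move=> hd hk fd f1.
have n0 : (n%:R : rat) != 0 by rewrite pnatr_eq0 -lt0n; apply/card_gt0P; exists x0.
have sumJ : \sum_(i < k.+1) A ^+ i = J.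
  apply/matrixP => i j; rewrite summxE [RHS]mxE.
  rewrite -[1]/(1%:R) -(f1 (enum_val i) (enum_val j)) natr_sum.
  by apply: eq_bigr => l _; rewrite adj_expE.
have AJ : A * J = d%:R *: J.
  apply/matrixP => i j; rewrite !mxE mulr1 -(fd (enum_val i)) natr_sum [RHS]big_enum_val.
  by apply: eq_bigr => l _; rewrite !mxE mulr1.
have JA : J * A = d%:R *: J.
  rewrite -AJ -sumJ mulr_sumr mulr_suml; apply: eq_bigr => i _.
  by rewrite -exprS -exprSr.
have JJ : J * J = n%:R *: J.
  apply/matrixP => i j; rewrite !mxE (eq_bigr (fun=> 1)) => [|l _]; last by rewrite !mxE mulr1.
  by rewrite sumr_const card_ord mulr1.
(* On the all-ones vector [A ^+ i] acts as d^i and [J] as n, so subtracting [c i *: J] replaces the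
   eigenvalue d^i by 1. *)
pose c i : rat := (d%:R ^+ i - 1) / n%:R.
have ZAr a (X Y : 'M[rat]_n) : X * (a *: Y) = a *: (X * Y) by exact/esym/scalemxAr.
have ZAl a (X Y : 'M[rat]_n) : a *: X * Y = a *: (X * Y) by exact/esym/scalemxAl.
have AiJ i : A ^+ i * J = d%:R ^+ i *: J.
  elim: i => [|i IHi]; first by rewrite !expr0 mul1r scale1r.
  by rewrite exprS -mulrA IHi ZAr AJ scalerA exprSr.
pose B := A - c 1%N *: J.
have BE i : B ^+ i = A ^+ i - c i *: J.
  elim: i => [|i IHi]; first by rewrite /c !expr0 subrr mul0r scale0r subr0.
  rewrite exprSr IHi /B mulrBr !mulrBl -exprSr !ZAr !ZAl AiJ JA JJ.
  rewrite !scalerA -!scalerBl -addrA -opprD -!scalerDl; congr (_ - _ *: _).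
  by rewrite /c expr1 exprSr; field.
(* Multiplying the geometric sum [J] by [A] gives J + A^(k+1) - 1, and this is also d J. *)
have Ak1 : A ^+ k.+1 = 1 + (d%:R - 1) *: J.
  have : A * J = J + A ^+ k.+1 - 1.
    rewrite -{1}sumJ mulr_sumr big_ord_recr /= -exprS -sumJ big_ord_recl expr0.
    rewrite -[1 + _ + _]addrA [1 + _]addrC addrK; congr (_ + _).
    by apply: eq_bigr => i _; rewrite -exprS.
  rewrite AJ scalerBl scale1r => ->.
  by rewrite [J + _]addrC [X in 1 + X]addrAC addrK [RHS]addrC subrK.
have ck : c k.+1 = d%:R - 1.
  have := AiJ k.+1; rewrite Ak1 mulrDl mul1r ZAl JJ scalerA.
  move/matrixP/(_ (enum_rank x0) (enum_rank x0)); rewrite !mxE !mulr1 /c => <-.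
  by rewrite addrAC subrr add0r mulfK.
have Bk1 : B ^+ k.+1 = 1 by rewrite BE ck Ak1 addrK.
(* A closed walk of such a length would compete with the walk of length 0. *)
have trA i : (0 < i <= k)%N -> \tr (A ^+ i) = 0.
  case/andP=> i0 ik; apply: big1 => j _; rewrite adj_expE; apply/eqP.
  rewrite pnatr_eq0 -leqn0 leqNgt; apply: contraL i0 => i_walk; rewrite -eqn0Ngt eq_sym.
  apply/eqP/(nwalks_length (eq_leq (f1 (enum_val j) (enum_val j)))) => //.
  by rewrite nwalks0 eqxx.
have trB i : (0 < i <= k)%N -> \tr (B ^+ i) = 1 - d%:R ^+ i.
  move=> ik; rewrite BE raddfB /= linearZ /= trA // sub0r.
  rewrite /mxtrace (eq_bigr (fun=> 1)) => [|j _]; last by rewrite mxE.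
  by rewrite sumr_const card_ord /c -mulrA mulVf // mulr1 opprB.
(* This reads 1 - d^k = 1 - d, which forces k = 1. *)
have := mxtrace_finite_order Bk1.
rewrite -[B in RHS]expr1 !trB ?leqnn ?ltnS ?(ltnW hk) //.
move/(congr1 (fun x => 1 - x)); rewrite !subKr -!natrX => /eqP; rewrite eqr_nat.
by rewrite eqn_exp2l // => /eqP k1; rewrite k1 in hk.
Qed.

End MooreDigraph.

(** * The outlier function and diregularity *)

Section Outlier.
Variables (T : finType) (e : rel T) (k : nat) (o : T -> T).
Local Notation adj := (fun x y => nat_of_bool (e x y)).
(** One identity encodes both uniqueness of short walks and the outlier; in this form it passes to
    the fixed subdigraph. *)
Hypothesis oP : forall u v, nball adj k u v + (o u == v) = 1.

Local Notation walk i u v := (0 < nwalks adj i u v).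

Lemma walkS i u v : reflect (exists2 w, e u w & walk i w v) (walk i.+1 u v).
Proof.
rewrite lt0n sum_nat_eq0 negb_forall; apply: (iffP existsP) => -[w].
  by rewrite implyTb muln_eq0 eqb0 negb_or negbK -lt0n => /andP[]; exists w.
by move=> uw wv; exists w; rewrite uw mul1n -lt0n.
Qed.

Lemma walk0 u : walk 0 u u.
Proof. by rewrite /= eqxx. Qed.

Lemma walk1 u v : e u v -> walk 1 u v.
Proof. by rewrite nwalks1 => ->. Qed.

Lemma walk_cons i u w v : e u w -> walk i w v -> walk i.+1 u v.
Proof. by move=> uw wv; apply/walkS; exists w. Qed.

Lemma walk_cat i j u w v : walk i u w -> walk j w v -> walk (i + j) u v.
Proof.
elim: i u => [|i IHi] u; first by rewrite nwalks0; case: eqP => // ->.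
by case/walkS => x ux xw wv; apply: walk_cons ux (IHi _ xw wv).
Qed.

Lemma walk_length i j u v :
  i <= k -> j <= k -> walk i u v -> walk j u v -> i = j.
Proof. by apply: nwalks_length; rewrite -(oP u v) leq_addr. Qed.

(** Prefixing the arcs out of u gives walks of length at most k from u to v; their lengths agree,
    and distinct first steps would count twice. *)
Lemma walk_branch i j u w w' v : i < k -> j < k -> e u w -> e u w' ->
  walk i w v -> walk j w' v -> w = w'.
Proof.
move=> ik jk uw uw' wv w'v.
have ij : i = j.
  by apply: succn_inj; apply: walk_length ik jk (walk_cons uw wv) (walk_cons uw' w'v).
rewrite -{}ij in w'v; apply/eqP; have := leq_addr (o u == v) (nball adj k u v).
rewrite oP /nball (bigD1 (Ordinal (ik : i.+1 < k.+1))) //= (bigD1 w) //= uw.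
apply: contraTT => ww'; rewrite (bigD1 w') /=; last by rewrite eq_sym.
by rewrite uw' -ltnNge; move: wv w'v; rewrite !mul1n; lia.
Qed.

Lemma outlier_reach u v : o u != v -> exists2 i, i <= k & walk i u v.
Proof.
move=> uv; have /eqP : nball adj k u v != 0.
  by have := oP u v; rewrite (negbTE uv) addn0 => ->.
move/eqP; rewrite sum_nat_eq0 negb_forall => /existsP[i].
by rewrite implyTb -lt0n => iw; exists i; rewrite // -ltnS.
Qed.

Lemma outlier_unreached i u : i <= k -> walk i u (o u) -> False.
Proof.
move=> ik; have /eqP := oP u (o u); rewrite eqxx addn1 eqSS sum_nat_eq0.
by move/forallP/(_ (Ordinal (ik : i < k.+1))) => /eqP/=->.
Qed.

Lemma walk_outlier i u v : i <= k -> walk i u v -> o u != v.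
Proof. by move=> ik uv; apply/eqP => ouv; move: uv; rewrite -ouv => /(outlier_unreached ik). Qed.

(** Apply [oP] to both sides of [nball_comm]: an out-neighbour w of u reaches v once unless
    [o w = v], and u reaches an in-neighbour of v once unless it is [o u]. *)
Lemma degree_balance u v :
  \sum_w e u w + e (o u) v = \sum_w e w v + \sum_w e u w * (o w == v).
Proof.
have /eqP := nball_comm adj k u v.
have -> : \sum_w e u w = \sum_w e u w * nball adj k w v + \sum_w e u w * (o w == v).
  by rewrite -big_split; apply: eq_bigr => w _; rewrite /= -mulnDr oP muln1.
have -> : \sum_w e w v = \sum_w nball adj k u w * e w v + e (o u) v.
  transitivity (\sum_w (nball adj k u w * e w v + (o u == w) * e w v)).
    by apply: eq_bigr => w _; rewrite -mulnDl oP mul1n.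
  rewrite big_split; congr (_ + _); rewrite (bigD1 (o u)) //= eqxx mul1n.
  by rewrite big1 ?addn0 // => w; rewrite eq_sym => /negbTE->.
by move/eqP->; rewrite addnAC.
Qed.

Section OutRegular.
Variable d : nat.
Hypothesis k_gt1 : 1 < k.
Hypothesis d_gt1 : 1 < d.
Hypothesis out_reg : forall u, \sum_v e u v = d.

(* Otherwise the image of [o] consists of two vertices with the same
   out-neighbourhood, and merging them yields a Moore digraph. *)
Lemma in_regular v : \sum_u e u v = d.
Proof.
apply/eqP/negPn/negP => v_irr.
(* The average in-degree is d. *)
have [v0 v0_gt] : exists v0, d < \sum_u e u v0.
  case: (pickP (fun x => d < \sum_u e u x)) => [x|in_le]; first by exists x.
  have in_le' x : true -> \sum_u e u x <= d ?= iff (\sum_u e u x == d).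
    by move=> _; split=> //; rewrite leqNgt in_le.
  have := leqif_sum in_le'; rewrite exchange_big /=.
  rewrite (eq_bigr (fun=> d)) => [|u _]; last exact: out_reg.
  by case=> _; rewrite eqxx => /esym/forallP/(_ v); rewrite (negbTE v_irr).
have gt_o t u : d < \sum_w e w t -> e (o u) t.
  move=> t_gt; have := degree_balance u t; rewrite out_reg.
  by case: (e _ _) => //; move: t_gt; lia.
(* Otherwise the balance makes t an outlier, so t -> v0 by [gt_o], and [o u] has walks of lengths 1
   and 2 to v0. *)
have o_gt t u : e (o u) t -> d < \sum_w e w t.
  move=> out; rewrite ltnNge; apply/negP => t_le.
  have : 0 < \sum_w e u w * (o w == t).
    by have := degree_balance u t; rewrite out_reg out; move: t_le; lia.
  rewrite lt0n sum_nat_eq0 negb_forall => /existsP[w].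
  rewrite implyTb muln_eq0 !eqb0 negb_or !negbK => /andP[_ /eqP owt].
  have tv0 : e t v0 by rewrite -owt gt_o.
  have := walk_length _ _ (walk1 (gt_o v0 u v0_gt)) (walk_cons out (walk1 tv0)).
  by move=> /(_ (ltnW k_gt1) k_gt1).
have same_out u u' t : e (o u) t = e (o u') t.
  by apply/idP/idP => /o_gt/gt_o.
(* Out-neighbourhoods of outliers agree, so a short walk from [o u] to [o u'] could start at [o u']
   instead and would be closed. *)
have oo u u' : o u != o u' -> o (o u) = o u'.
  move=> uu'; apply/eqP/negPn/negP => /outlier_reach[[|i] ik].
    by rewrite nwalks0 (negbTE uu').
  rewrite nwalksS (eq_bigr (fun w => e (o u') w * nwalks adj i w (o u'))).
    by move/(walk_length ik (leq0n _))/(_ (walk0 _)).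
  by move=> w _; rewrite (same_out u u').
have o_neq u : o u != u by apply/eqP => ou; apply: (@outlier_unreached 0 u); rewrite // ou walk0.
pose a := o v; pose b := o a.
have ab : a != b by rewrite eq_sym o_neq.
have o_ab w : o w = a \/ o w = b.
  case: (eqVneq (o v) (o w)) => [<-|/oo <-]; [by left | by right].
have sub_sum (F : T -> nat) : \sum_(x : {x | x \in predC1 b}) F (val x) + F b = \sum_x F x.
  by rewrite -big_sub [RHS](bigD1 b) //= addnC.
(* Delete [b] and redirect its incoming arcs to [a]; the arcs out of [a] and [b] agree already. *)
pose f (x y : {x | x \in predC1 b}) :=
  e (val x) (val y) + (val y == a) * e (val x) b.
have f_sum x : \sum_y f x y = d.
  rewrite big_split -big_distrl -(out_reg (val x)) -(sub_sum (e (val x))); congr (_ + _).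
  have := sub_sum (fun y => y == a); rewrite /= eq_sym (negbTE ab) addn0 => ->.
  by rewrite (bigD1 a) //= eqxx big1 ?mul1n // => y /negbTE->.
have f_walks i x y : nwalks f i x y =
    nwalks adj i (val x) (val y) + (val y == a) * nwalks adj i (val x) b.
  elim: i y => [|i IHi] y.
    rewrite !nwalks0 -val_eqE; have /negbTE-> := valP x; by rewrite muln0 addn0.
  have f_out z : e a (val z) + (val z == a) * e a b = e b (val z) + (val z == a) * e b b.
    by rewrite (same_out v a (val z)) (same_out v a b).
  rewrite !nwalksSr -(sub_sum (fun w => nwalks adj i (val x) w * e w (val y))).
  rewrite -(sub_sum (fun w => nwalks adj i (val x) w * e w b)).
  rewrite mulnDr addnACA big_distrr -big_split /=.
  rewrite (eq_bigr (fun w : {x | x \in predC1 b} => nwalks adj i (val x) (val w) * f w y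
     + (val w == a) * (nwalks adj i (val x) b * f w y))); last first.
    by move=> w _; rewrite IHi mulnDl mulnA.
  rewrite big_split; congr (_ + _).
    by apply: eq_bigr => w _; rewrite mulnDr mulnCA.
  have := sub_sum (fun w =>
    (w == a) * (nwalks adj i (val x) b * (e w (val y) + (val y == a) * e w b))).
  rewrite /= [b == a]eq_sym (negbTE ab) addn0 => ->.
  rewrite (bigD1 a) //= eqxx big1 ?addn0 ?mul1n; last by move=> w /negbTE->.
  by rewrite f_out mulnDr mulnCA.
(* Every vertex has exactly one of [a] and [b] as its outlier, so it reaches the merged vertex
   exactly once. *)
have f_ball x y : nball f k x y = 1.
  have -> : nball f k x y = nball adj k (val x) (val y) + (val y == a) * nball adj k (val x) b.
    rewrite [in X in _ + X]/nball big_distrr -big_split.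
    by apply: eq_bigr => i _; rewrite f_walks.
  have := oP (val x) (val y); have := oP (val x) b; have := valP y.
  rewrite inE; case: (eqVneq (val y) a) => [-> _|ya yb].
    by case: (o_ab (val x)) => ->; rewrite ?eqxx ?[b == a]eq_sym (negbTE ab); lia.
  by case: (o_ab (val x)) => ->; rewrite [_ == val y]eq_sym ?(negbTE ya) ?(negbTE yb); lia.
have a' : a \in predC1 b by rewrite inE.
exact: (no_moore_digraph (exist _ a a') d_gt1 k_gt1 f_sum f_ball).
Qed.

End OutRegular.
End Outlier.

(** * Predicates with two elements *)

Section CardTwo.
Variables (T : finType) (P : pred T).

Lemma sum_pred : \sum_x (P x : nat) = #|P|.
Proof.
by rewrite -sum1_card [RHS]big_mkcond; apply: eq_bigr => x _; rewrite unfold_in; case: (P x).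
Qed.

Hypothesis P2 : \sum_x (P x : nat) = 2.

Lemma pair_other x : P x -> exists2 y, P y & x != y.
Proof.
move=> Px; have : 0 < #|[predD1 P & x]|.
  by move: P2; rewrite sum_pred (cardD1 x) (Px : x \in P) add1n => -[->].
by case/card_gt0P=> y; rewrite inE eq_sym => /andP[xy Py]; exists y.
Qed.

Lemma pair_cover x y z : x != y -> P x -> P y -> P z -> z = x \/ z = y.
Proof.
move=> xy Px Py Pz; move: P2; rewrite sum_pred => P2'.
case: (eqVneq z x) => [->|zx]; first by left.
case: (eqVneq z y) => [->|zy]; first by right.
have : 2 < #|P| by apply/card_gt2P; exists x, y, z; rewrite [y == z]eq_sym.
by rewrite P2'.
Qed.

End CardTwo.

(** * The outlier function of a diregular digraph is an automorphism *)

Section OutlierRegular.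
Variables (T : finType) (e : rel T) (k : nat) (o : T -> T) (d : nat).
Local Notation adj := (fun x y => nat_of_bool (e x y)).
Hypothesis oP : forall u v, nball adj k u v + (o u == v) = 1.
Hypothesis out_reg : forall u, \sum_v e u v = d.
Hypothesis in_reg : forall v, \sum_u e u v = d.
Local Notation walk i u v := (0 < nwalks adj i u v).

Lemma card_outlier (u : T) : #|T| = moore d k + 1.
Proof.
have o1 : \sum_v (o u == v) = 1.
  by rewrite (bigD1 (o u)) //= eqxx big1 // => v; rewrite eq_sym => /negbTE->.
rewrite -sum1_card -(sum_nball k u out_reg) -[X in _ + X]o1 -big_split.
by apply: eq_bigr => v _; rewrite /= oP.
Qed.

(** Counting walks by their end, each vertex is missed by as many vertices as the order exceeds the
    Moore bound, that is by one. *)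
Lemma outlier_inj : injective o.
Proof.
move=> u u' ouu'; apply/eqP; apply: contraT => uu'.
have : #|T| = moore d k + \sum_x (o x == o u).
  rewrite -sum1_card -(sum_nball_in k (o u) in_reg) -big_split.
  by apply: eq_bigr => v _; rewrite /= oP.
rewrite (card_outlier u) (bigD1 u) //= eqxx (bigD1 u') /=; last by rewrite eq_sym.
by rewrite -ouu' eqxx; lia.
Qed.

Lemma outlier_arc u v : e (o u) v = \sum_w e u w * (o w == v) :> nat.
Proof. by have := degree_balance oP u v; rewrite out_reg in_reg => /addnI. Qed.

Lemma outlier_automorphism u v : e (o u) (o v) = e u v.
Proof.
have : e (o u) (o v) = e u v :> nat; last by case: (e _ _); case: (e _ _).
rewrite outlier_arc (bigD1 v) //= eqxx muln1 big1 ?addn0 // => w wv.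
by rewrite (inj_eq outlier_inj) (negbTE wv) muln0.
Qed.

End OutlierRegular.

(** * Nonexistence in degree two *)

Section DegreeTwo.
Variables (T : finType) (e : rel T) (k : nat) (o : T -> T).
Local Notation adj := (fun x y => nat_of_bool (e x y)).
Hypothesis oP : forall u v, nball adj k u v + (o u == v) = 1.
Hypothesis k_gt1 : 1 < k.
Hypothesis out_reg : forall u, \sum_v e u v = 2.
Local Notation walk i u v := (0 < nwalks adj i u v).

Let in_reg v : \sum_u e u v = 2 := in_regular oP k_gt1 (isT : 1 < 2) out_reg v.
Let o_inj : injective o := outlier_inj oP out_reg in_reg.
Let o_auto u v : e (o u) (o v) = e u v := outlier_automorphism oP out_reg in_reg u v.
Let out_cover u x y z : x != y -> e u x -> e u y -> e u z -> z = x \/ z = y.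
Proof. exact: (@pair_cover _ (e u) (out_reg u)). Qed.

Let out_arc w : exists t, e w t.
Proof.
have : \sum_t e w t != 0 by rewrite out_reg.
by rewrite sum_nat_eq0 negb_forall => /existsP[t]; rewrite implyTb eqb0 negbK; exists t.
Qed.

Let o_neq u : o u != u.
Proof. by apply: (walk_outlier oP (leq0n k)); rewrite walk0. Qed.

Let k1 : k.-1 < k. Proof. by rewrite prednK // ltnW. Qed.

Let no_cycle i u : 0 < i <= k -> ~~ walk i u u.
Proof.
case/andP=> i0 ik; apply/negP => uu.
by have := walk_length oP ik (leq0n k) uu (walk0 e u); move: i0; case: i {ik uu}.
Qed.

Section CommonOutNeighbour.
Variables u v x y z : T.
Hypotheses (uv : u != v) (ux : e u x) (uy : e u y) (xy : x != y).
Hypotheses (vx : e v x) (vz : e v z) (xz : x != z).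

(** A short walk from u to v through x would close to a short cycle by the arc v -> x; one through
    y, if not of full length k, would yield a second short walk from u to x. *)
Lemma common_out_walk : o u = v \/ walk k.-1 y v.
Proof.
case: (eqVneq (o u) v) => [|/(outlier_reach oP)[[|i] ik]]; first by left.
  by rewrite nwalks0 (negbTE uv).
case/walkS=> w uw wv; case: (out_cover xy ux uy uw) => wE; rewrite {w}wE in uw wv.
  have := walk_cat wv (walk1 vx); rewrite addn1 => xx.
  by have := @no_cycle i.+1 x ik; rewrite xx.
right; have [<- //|ik1] := eqVneq i k.-1.
have ik2 : i.+1 < k by lia.
have := walk_cat wv (walk1 vx); rewrite addn1 => yx.
have yxE := walk_branch oP ik2 (ltnW k_gt1) uy ux yx (walk0 _ _).
by move: xy; rewrite yxE eqxx.
Qed.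

End CommonOutNeighbour.

(** A nontrivial short walk from u to z through x rivals the arc v -> z, and one through y rivals
    the walk of length k from y through v to z. The trivial one, z = u, is excluded by
    [common_out_walk] with u and v exchanged. *)
Lemma common_out_far u v x y z : u != v -> e u x -> e u y -> x != y ->
  e v x -> e v z -> x != z -> walk k.-1 y v -> o u = z.
Proof.
move=> uv ux uy xy vx vz xz yv; apply/eqP/negPn/negP => /(outlier_reach oP)[[|i] ik].
  rewrite nwalks0 lt0b => /eqP uz; rewrite -uz in vz xz.
  have vu : v != u by rewrite eq_sym.
  case: (common_out_walk vu vx vz xz ux uy xy) => [ov|].
    by have := walk_outlier oP (ltnW k_gt1) (walk1 vz); rewrite ov eqxx.
  by apply/negP/no_cycle; lia.
case/walkS=> w uw wz; case: (out_cover xy ux uy uw) => wE; rewrite {w}wE in uw wz.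
  have := walk_branch oP ik (ltnW k_gt1) vx vz wz (walk0 _ _).
  by move/eqP; rewrite (negbTE xz).
have := walk_cat yv (walk1 vz); rewrite addn1 prednK ?(ltnW k_gt1) // => yz.
have := walk_length oP (ltnW ik) (leqnn k) wz yz; lia.
Qed.

(** The automorphism [o] maps the out-neighbours x, y of u to those of v, and it has no fixed point,
    so o x = z and o y = x. If o v = u, the same argument at v gives o x = y. *)
Lemma common_out_outlier u v x y z : u != v -> e u x -> e u y -> x != y ->
  e v x -> e v z -> x != z -> o u = v -> [/\ o v = u, y = z & o x = y].
Proof.
move=> uv ux uy xy vx vz xz ouv.
have ox : o x = z.
  have : e v (o x) by rewrite -ouv o_auto.
  by case/(out_cover xz vx vz) => // oxx; have := o_neq x; rewrite oxx eqxx.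
have oy : o y = x.
  have : e v (o y) by rewrite -ouv o_auto.
  case/(out_cover xz vx vz) => // oyz.
  by have := o_inj (etrans ox (esym oyz)) => /eqP; rewrite (negbTE xy).
have [ovu|ovu] := eqVneq (o v) u.
  have ox' : o x = y.
    have : e u (o x) by rewrite -ovu o_auto.
    by case/(out_cover xy ux uy) => // oxx; have := o_neq x; rewrite oxx eqxx.
  by rewrite -ox' ox.
exfalso.
have u'z : e (o v) z by rewrite -ox o_auto.
have vov : v != o v by rewrite eq_sym o_neq.
have [i ik yu'] : exists2 i, i < k & walk i y (o v).
  have /(outlier_reach oP)[[|i] ik] : o u != o v by rewrite (inj_eq o_inj).
    by rewrite nwalks0 lt0b => /eqP uov; rewrite -uov eqxx in ovu.
  case/walkS=> w uw wov; case: (out_cover xy ux uy uw) => wE; rewrite {w}wE in uw wov.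
    by case: (outlier_unreached oP ik (walk_cons vx wov)).
  by exists i.
have := walk_cat yu' (walk1 u'z); rewrite addn1 => yz.
(* If shorter, the walk from y to z is moved by [o] to one from x to [o z], which y reaches in
   equally many steps through [o v]. *)
have ik1 : i.+1 = k.
  apply/eqP; rewrite eqn_leq ik leqNgt; apply/negP => ik2.
  have walk_o j s t : walk j s t -> walk j (o s) (o t).
    elim: j s => [|j IHj] s; first by rewrite !nwalks0 (inj_eq o_inj).
    by case/walkS=> w sw wt; apply: (walk_cons (w := o w)); [rewrite o_auto | exact: IHj].
  have xoz : walk i.+1 x (o z) by rewrite -oy walk_o.
  have yoz : walk i.+1 y (o z).
    have : e (o v) (o z) by rewrite o_auto.
    by move/walk1/(walk_cat yu'); rewrite addn1.
  by have := walk_branch oP ik2 ik2 ux uy xoz yoz => /eqP; rewrite (negbTE xy).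
have zu : z = u.
  apply/esym/eqP; apply: contraT => uz.
  have /(outlier_reach oP)[[|j] jk] : o u != z.
    rewrite ouv; apply/eqP => vzE; move: (walk1 vz); rewrite -vzE.
    by apply/negP/no_cycle; exact: ltnW.
    by rewrite nwalks0 (negbTE uz).
  case/walkS=> w uw wz; case: (out_cover xy ux uy uw) => wE; rewrite {w}wE in uw wz.
    by have := walk_branch oP jk (ltnW k_gt1) vx vz wz (walk0 _ _) => /eqP; rewrite (negbTE xz).
  by have := walk_length oP (ltnW jk) ik wz yz; rewrite ik1 => jE; rewrite jE ltnn in jk.
have [t yt] := out_arc y.
(* Since o (o y) = u, some out-neighbour t' of y has o (o t') = x, hence o t' = y; applying [o] to y
   -> t' gives x -> y, against u -> x and u -> y. *)
have tau w : e y w -> e u (o (o w)) by move=> yw; rewrite -zu -ox -oy !o_auto.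
have [t' yt' oot'] : exists2 t', e y t' & o (o t') = x.
  case: (pair_other (out_reg y) yt) => s ys ts.
  case: (out_cover xy ux uy (tau _ yt)) => [|tE]; first by exists t.
  case: (out_cover xy ux uy (tau _ ys)) => [|sE]; first by exists s.
  by move: ts; rewrite (o_inj (o_inj (etrans tE (esym sE)))) eqxx.
have ot' : o t' = y by apply: o_inj; rewrite oot' oy.
have xyarc : e x y by have := o_auto y t'; rewrite oy ot' yt'.
have := walk_branch oP k_gt1 (ltnW k_gt1) ux uy (walk1 xyarc) (walk0 _ _).
by move/eqP; rewrite (negbTE xy).
Qed.

Lemma common_out_cases u v x y z : u != v -> e u x -> e u y -> x != y ->
  e v x -> e v z -> x != z ->
  [/\ o u = v, y = z & o x = y] \/ (o u = z /\ o v = y).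
Proof.
move=> uv ux uy xy vx vz xz; have vu : v != u by rewrite eq_sym.
case: (common_out_walk uv ux uy xy vx vz xz) => [ouv|yv].
  by left; case: (common_out_outlier uv ux uy xy vx vz xz ouv).
case: (common_out_walk vu vx vz xz ux uy xy) => [ovu|zu].
  by left; case: (common_out_outlier vu vx vz xz ux uy xy ovu) => ? -> ->.
right; split; first exact: (common_out_far uv ux uy xy vx vz xz yv).
exact: (common_out_far vu vx vz xz ux uy xy zu).
Qed.

Let two_step u x y t : e u x -> e u y -> x != y -> e x t -> e y t -> False.
Proof.
move=> ux uy xy xt yt.
by have := walk_branch oP k_gt1 k_gt1 ux uy (walk1 xt) (walk1 yt) => /eqP; rewrite (negbTE xy).
Qed.

(** To exclude o u = z and o v = y, apply the dichotomy to u and the other in-neighbour w of y.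
    Either w -> x, so w = v, which has no arc to y; or o w = x and w -> z, so x and y both have an
    arc to [o z]. *)
Lemma common_out_double u v x y z : u != v -> e u x -> e u y -> x != y ->
  e v x -> e v z -> x != z -> [/\ o u = v, y = z & o x = y].
Proof.
move=> uv ux uy xy vx vz xz.
case: (common_out_cases uv ux uy xy vx vz xz) => // -[ouz ovy]; exfalso.
have yz : y != z by rewrite -ouz -ovy (inj_eq o_inj) eq_sym.
have [w wy uw] := pair_other (P := e^~ y) (in_reg y) uy.
have [r wr yr] := pair_other (out_reg w) wy.
have yx : y != x by rewrite eq_sym.
case: (common_out_cases uw uy ux yx wy wr yr) => [[_ xr _]|[our ow]].
  rewrite -xr in wr.
  case: (pair_cover (P := e^~ x) (in_reg x) uv ux vx wr) => wE.
    by rewrite wE eqxx in uw.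
  by case: (out_cover xz vx vz (_ : e v y)) => [|/eqP|/eqP];
    rewrite -?wE // ?(negbTE yx) ?(negbTE yz).
have xoz : e x (o z) by rewrite -ow o_auto -ouz our.
have yoz : e y (o z) by rewrite -ovy o_auto.
exact: two_step ux uy xy xoz yoz.
Qed.

(** By [common_out_double], [o x] is the other out-neighbour of any u -> x and the other
    in-neighbour of any t with x -> t, giving two walks of length 2 from u to t. *)
Lemma no_degree_two : T -> False.
Proof.
move=> u.
have pairs w t : e w t -> exists v s, [/\ e w s, t != s, o w = v & e v t /\ o t = s].
  move=> wt; have [s ws ts] := pair_other (out_reg w) wt.
  have [v vt wv] := pair_other (P := e^~ t) (in_reg t) wt.
  have [r vr tr] := pair_other (out_reg v) vt.
  by have [? ? ?] := common_out_double wv wt ws ts vt vr tr; exists v, s.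
have [x ux] := out_arc u; have [t xt] := out_arc x.
have [_ [y [uy xy _ [_ ox]]]] := pairs _ _ ux.
have [y' [_ [_ _ ox' [yt _]]]] := pairs _ _ xt.
rewrite -ox' ox in yt.
exact: two_step ux uy xy xt yt.
Qed.

End DegreeTwo.

(** * From geodetic digraphs to walk counts *)

Section Digraph.
Variable G : digraph.
Local Notation adj := (fun x y : G => nat_of_bool (arc x y)).
Local Notation walk i u v := (0 < nwalks adj i u v).

Lemma outdegE (u : G) : outdeg u = \sum_v arc u v.
Proof. by rewrite /outdeg cardsE sum_pred. Qed.

Lemma walk_diwalk i (u v : G) : walk i u v -> exists2 p, diwalk u p v & size p = i.
Proof.
elim: i u => [|i IHi] u.
  by rewrite nwalks0 lt0b => uv; exists [::].
case/walkS=> w uw /IHi[p /andP[wp pv] <-].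
by exists (w :: p); rewrite // /diwalk /= uw wp.
Qed.

Lemma sum_le1 (I : finType) (F : I -> nat) : (forall i, F i <= 1) ->
  (forall i j, 0 < F i -> 0 < F j -> i = j) -> \sum_i F i <= 1.
Proof.
move=> F1 Funiq; case: (pickP (fun i => 0 < F i)) => [i Fi|F0].
  rewrite (bigD1 i) //= big1 ?addn0 // => j ji; apply/eqP; rewrite -leqn0 leqNgt.
  by apply: contra ji => Fj; apply/eqP/Funiq.
by rewrite big1 // => i _; apply/eqP; rewrite -leqn0 leqNgt F0.
Qed.

Lemma geodetic_nball k (u v : G) : geodetic k G -> nball adj k u v <= 1.
Proof.
move=> geo.
have uniq_walk i j w : i <= k -> j <= k -> forall p q,
    diwalk u p w -> size p = i -> diwalk u q w -> size q = j -> p = q.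
  by move=> ik jk p q up pi uq qj; apply: geo up _ uq _; rewrite ?pi ?qj.
have walk_le1 i w : i <= k -> nwalks adj i w v <= 1.
  elim: i w => [|i IHi] w ik; first by rewrite nwalks0 leq_b1.
  apply: sum_le1 => [x|x y].
    by have := IHi x (ltnW ik); case: (arc w x); rewrite ?mul1n.
  rewrite !muln_gt0 !lt0b => /andP[wx /walk_diwalk[p /andP[xp pv] pi]].
  case/andP=> wy /walk_diwalk[q /andP[yq qv] qi].
  have: x :: p = y :: q by apply: (geo w v); rewrite /diwalk //= ?pi ?qi // ?wx ?wy ?xp ?yq.
  by case.
apply: sum_le1 => [i|i j]; first by apply: walk_le1; rewrite -ltnS.
case/walk_diwalk=> p up pi /walk_diwalk[q uq qj]; apply: val_inj => /=.
by rewrite -pi -qj (geo u v p q) // ?pi ?qj -ltnS.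
Qed.

Lemma moore_cons d k : moore d k.+1 = 1 + d * moore d k.
Proof.
rewrite /moore big_ord_recl expn0 big_distrr; congr (_ + _).
by apply: eq_bigr => i _; rewrite /= -expnS.
Qed.

Lemma sum_nballS k (u : G) :
  \sum_v nball adj k.+1 u v = 1 + \sum_v \sum_w arc u w * nball adj k w v.
Proof.
under eq_bigr do rewrite nballS.
rewrite big_split (bigD1 u) //= eqxx big1 // => v.
by rewrite eq_sym => /negbTE->.
Qed.

Lemma nball_sum_ge d k (u : G) : (forall x : G, d <= outdeg x) ->
  moore d k <= \sum_v nball adj k u v.
Proof.
move=> ge_d; elim: k u => [|k IHk] u.
  rewrite /moore big_ord1 (bigD1 u) //= /nball big_ord1 nwalks0 eqxx; exact: leq_addr.
rewrite moore_cons sum_nballS leq_add2l exchange_big /=.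
apply: leq_trans (_ : \sum_w arc u w * moore d k <= _).
  by rewrite -big_distrl -outdegE leq_mul2r ge_d orbT.
by apply: leq_sum => w _; rewrite -big_distrr leq_mul2l IHk orbT.
Qed.

(** Out-degree above d would give at least 1 + (d+1) M(d,k-1) = M(d,k) + M(d,k-1) short walks with
    distinct ends, more than the order. *)
Lemma excess_one_out_regular d k : 1 < d -> 1 < k -> excess_one d k G ->
  forall u : G, \sum_v arc u v = d.
Proof.
move=> d1; case: k => // k k1 [geo [_ ge_d] cardG] u; rewrite -outdegE; apply/eqP.
rewrite eqn_leq ge_d andbT leqNgt; apply/negP => gt_d.
have : \sum_v nball adj k.+1 u v <= moore d k.+1 + 1.
  rewrite -cardG -sum1_card; apply: leq_sum => v _; exact: geodetic_nball.
apply/negP; rewrite -ltnNge moore_cons.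
have : (outdeg u) * moore d k <= \sum_v \sum_w arc u w * nball adj k w v.
  rewrite exchange_big outdegE big_distrl; apply: leq_sum => w _.
  by rewrite -big_distrr leq_mul2l nball_sum_ge ?orbT.
have : d.+1 * moore d k <= outdeg u * moore d k by rewrite leq_mul2r gt_d orbT.
have : 2 < moore d k.
  case: k k1 {geo cardG} => // k _; rewrite moore_cons.
  have : 0 < moore d k by rewrite /moore big_ord_recl.
  nia.
rewrite sum_nballS; lia.
Qed.

(** The counts from u are at most 1 and total one less than the order, so exactly one vertex is
    missed. *)
Lemma excess_one_outlier d k : 1 < d -> 1 < k -> excess_one d k G ->
  exists o : G -> G, forall u v, nball adj k u v + (o u == v) = 1.
Proof.
move=> d1 k1 exG; have out_reg := excess_one_out_regular d1 k1 exG.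
case: exG => geo _ cardG.
apply: (@fin_all_exists _ _ (fun u w => forall v, nball adj k u v + (w == v) = 1)) => u.
have le1 v := geodetic_nball u v geo.
have : \sum_v (1 - nball adj k u v) = 1.
  apply/(@addnI (moore d k)); rewrite -cardG -(sum_nball k u out_reg) -big_split -sum1_card.
  by apply: eq_bigr => v _; rewrite /= subnKC.
move/eqP/sum_nat_eq1 => [w [_ w1 w0]]; exists w => v; have := le1 v.
case: eqVneq => [<-|wv]; first by move: w1; lia.
have := w0 v; rewrite eq_sym wv => /(_ isT isT); lia.
Qed.

End Digraph.

(* The balance equation loses its outlier terms when [o] is an automorphism. *)
Lemma automorphism_degree (T : finType) (e : rel T) k (o : T -> T) :
  (forall u v, nball (fun x y => e x y) k u v + (o u == v) = 1) ->
  injective o -> (forall u v, e (o u) (o v) = e u v) ->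
  forall u v, \sum_w e u w = \sum_w e w v.
Proof.
move=> oP o_inj o_auto u v.
have [o' oK o'K] := injF_bij o_inj; rewrite -[v]o'K.
have := degree_balance oP u (o (o' v)); rewrite o_auto.
have -> : \sum_w e u w * (o w == o (o' v)) = e u (o' v).
  rewrite (bigD1 (o' v)) //= eqxx muln1 big1 ?addn0 // => w wv.
  by rewrite (inj_eq o_inj) (negbTE wv) muln0.
by move/eqP; rewrite eqn_add2r => /eqP.
Qed.

Lemma leq_moore d d' k : d <= d' -> moore d k <= moore d' k.
Proof.
move=> dd'; apply: leq_sum => -[[|i] ik] _ //=.
by rewrite leq_exp2r.
Qed.

Lemma induced_geodetic k (G : digraph) (A : {set G}) : geodetic k G -> geodetic k (induced A).
Proof.
have walk_val (u v : induced A) p : diwalk u p v -> diwalk (val u) (map val p) (val v).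
  by case/andP=> up /eqP <-; rewrite /diwalk last_map eqxx andbT path_map.
move=> geo u v p q up pk uq qk; apply: (inj_map val_inj).
by apply: geo (walk_val _ _ _ up) _ (walk_val _ _ _ uq) _; rewrite size_map.
Qed.

(** * Degree one: the directed cycle *)

Section DirectedCycle.
Variables (H : digraph) (k : nat) (o : H -> H).
Local Notation adj := (fun x y : H => nat_of_bool (arc x y)).
Hypothesis oP : forall u v, nball adj k u v + (o u == v) = 1.
Hypothesis out_reg : forall u : H, \sum_v arc u v = 1.
Hypothesis in_reg : forall v : H, \sum_u arc u v = 1.

Lemma degree_one_dicycle (x0 : H) : 0 < k -> diso H (dicycle (k + 2)).
Proof.
move=> k_gt0.
have [s sE] : exists s : H -> H, forall u v, arc u v = (s u == v).
  apply: (@fin_all_exists _ _ (fun u w => forall v, arc u v = (w == v))) => u.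
  have /eqP/sum_nat_eq1[w [_ uw w0]] := out_reg u; exists w => v.
  case: eqVneq => [<-|wv]; first by move: uw; case: arc.
  by have := w0 v; rewrite eq_sym wv => /(_ isT isT); case: arc.
have s_inj : injective s.
  move=> u u' suu'; apply/eqP; have := in_reg (s u); rewrite (bigD1 u) //=.
  apply: contra_eqT => uu'; rewrite (bigD1 u') /=; last by rewrite eq_sym.
  by rewrite !sE suu' eqxx.
have iterE i u v : nwalks adj i u v = (iter i s u == v).
  elim: i u => [|i IHi] u //; rewrite nwalksS (bigD1 (s u)) //= sE eqxx mul1n IHi -iterSr.
  by rewrite big1 ?addn0 // => w; rewrite sE eq_sym => /negbTE->.
have reach u v : o u != v -> exists2 i, i <= k & iter i s u = v.
  by case/(outlier_reach oP) => i ik; rewrite iterE lt0b => /eqP; exists i.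
have unreached i u : i <= k -> iter i s u != o u.
  move=> ik; apply/eqP => iu; apply: (outlier_unreached oP ik (u := u)).
  by rewrite iterE iu eqxx.
have no_return m u : 0 < m <= k.+1 -> iter m s u != u.
  have short j w : 0 < j <= k -> iter j s w != w.
    case/andP=> j0 jk; apply: contraTneq j0 => jw; rewrite -leqNgt leqn0; apply/eqP.
    by apply: (walk_length oP jk (leq0n k) (u := w) (v := w)); rewrite iterE ?jw eqxx.
  case/andP=> m0; rewrite leq_eqVlt => /predU1P[->|mk]; last by apply: short; rewrite m0.
  (* After a return in k + 1 steps, the set reached within k steps would be closed under
     predecessors; it contains [s (o u)] but not [o u]. *)
  apply/eqP => return_u.
  have /reach[[|i] ik] : o u != s (o u) by rewrite eq_sym (short 1).
    by rewrite /= -{1}return_u /= => /s_inj/eqP; rewrite (negbTE (unreached _ _ _)).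
  by rewrite /= => /s_inj/eqP; rewrite (negbTE (unreached _ _ _)) // ltnW.
have iter_s_inj m : injective (iter m s) by elim: m => //= m IHm x y /s_inj/IHm.
have iter_inj i j : i < k + 2 -> j < k + 2 -> iter i s x0 = iter j s x0 -> i = j.
  wlog ij : i j / i <= j.
    by move=> wl ik jk ijE; case/orP: (leq_total i j) => ij; [|apply/esym]; apply: wl ij _ _ _.
  move=> _ jk; rewrite -{1}(subnKC ij) iterD => /iter_s_inj/esym/eqP jiE.
  by have := @no_return (j - i) x0; rewrite jiE; lia.
pose g (i : 'I_(k + 2)) := iter i s x0.
have g_inj : injective g by move=> i j /iter_inj ij; apply/val_inj/ij.
have cardH : #|H| = k + 2.
  rewrite (card_outlier oP out_reg x0) /moore.
  by under eq_bigr do rewrite exp1n; rewrite sum_nat_const card_ord muln1 addn1 addn2.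
have [f gK fK] : bijective g by apply: inj_card_bij; rewrite // card_ord cardH.
have gS i : g (ordS i) = s (g i).
  rewrite /g /= -iterS.
  have [ik|ik] := ltnP i.+1 (k + 2); first by rewrite modn_small.
  have -> : i.+1 = k + 2 by have := ltn_ord i; lia.
  (* The iterate k + 2 equals an earlier one; if that were not x0, cancelling [s] would identify two
     of the first k + 2 iterates. *)
  rewrite modnn /=; have := fK (iter (k + 2) s x0); rewrite /g.
  case: (f _) => -[|j] jk //=; rewrite addn2 /= => /s_inj jE.
  have := iter_inj j k.+1; rewrite addn2 in jk *; move/(_ (ltnW jk) (leqnn _) jE); lia.
exists f; split; first by exists g.
by move=> x y; rewrite sE -[in RHS](fK x) -gS -[in RHS](fK y) (inj_eq g_inj) eq_sym.
Qed.

End DirectedCycle.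

(** * The subdigraph of fixed vertices *)

Section FixedPoints.
Variables (G : digraph) (phi : {perm G}) (k : nat) (o : G -> G).
Local Notation adj := (fun x y : G => nat_of_bool (arc x y)).
Hypothesis oP : forall u v, nball adj k u v + (o u == v) = 1.
Hypothesis phi_auto : automorphism phi.

Lemma nwalks_perm i u v : nwalks adj i (phi u) (phi v) = nwalks adj i u v.
Proof.
elim: i u => [|i IHi] u; first by rewrite !nwalks0 (inj_eq perm_inj).
rewrite !nwalksS (reindex_inj (@perm_inj _ phi)) /=.
by apply: eq_bigr => w _; rewrite phi_auto IHi.
Qed.

Lemma outlier_perm u : o (phi u) = phi (o u).
Proof.
have ballE : nball adj k (phi u) (phi (o u)) = nball adj k u (o u).
  by apply: eq_bigr => i _; rewrite nwalks_perm.
have := oP (phi u) (phi (o u)); have := oP u (o u); rewrite ballE eqxx.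
by case: eqP => //; lia.
Qed.

(** A short walk between fixed vertices stays among them: if its first step w were moved, its image
    would be a second such walk. *)
Lemma nwalks_FIX i (u v : FIX phi) : i <= k ->
  nwalks (fun x y : FIX phi => arc x y) i u v = nwalks adj i (val u) (val v).
Proof.
elim: i u => [|i IHi] u ik //.
rewrite !nwalksS (bigID (mem [set x | phi x == x])) /= [X in _ = _ + X]big1 ?addn0.
  by rewrite [RHS]big_sub; apply: eq_bigr => w _; rewrite -IHi // ltnW.
move=> w; rewrite inE => phi_w; apply/eqP; rewrite -leqn0 leqNgt.
apply: contra phi_w; rewrite muln_gt0 lt0b => /andP[uw wv]; apply/eqP.
have fix_val (x : FIX phi) : phi (val x) = val x by have := valP x; rewrite inE => /eqP.
apply: (walk_branch oP ik ik _ uw _ wv); first by rewrite -[val u]fix_val phi_auto.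
by rewrite -[val v]fix_val nwalks_perm.
Qed.

Lemma FIX_outlier : injective o -> (forall u v, arc (o u) (o v) = arc u v) ->
  exists o' : FIX phi -> FIX phi,
    [/\ forall u v, nball (fun x y : FIX phi => arc x y) k u v + (o' u == v) = 1,
        injective o' & forall u v, arc (o' u) (o' v) = arc u v].
Proof.
move=> o_inj o_auto.
have o_fix (x : FIX phi) : o (val x) \in [set x | phi x == x].
  by have := valP x; rewrite !inE -outlier_perm => /eqP->.
exists (fun x => exist _ (o (val x)) (o_fix x)); split=> [u v|u v|u v].
- rewrite -[RHS](oP (val u) (val v)) -val_eqE; congr (_ + _).
  by apply: eq_bigr => i _; rewrite nwalks_FIX // -ltnS.
- by move/(congr1 val)/o_inj/val_inj.
- exact: o_auto.
Qed.

End FixedPoints.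

(** * Classification by the degree of the fixed subdigraph *)

Theorem corollary7 (d k : nat) (hd : 2 <= d) (hk : 2 <= k)
    (G : digraph) (hG : excess_one d k G)
    (phi : {perm G}) (hphi : automorphism phi) (hphi1 : phi <> 1%g) :
  [\/ null_digraph (FIX phi),
      two_isolated (FIX phi),
      diso (FIX phi) (dicycle (k + 2))
    | exists d' : nat, 3 <= d' <= d - 1 /\ excess_one d' k (FIX phi)].
Proof.
have [o oP] := excess_one_outlier hd hk hG.
have out_regG := excess_one_out_regular hd hk hG.
have in_regG := in_regular oP hk hd out_regG.
have [o' [oP' o'_inj o'_auto]] := FIX_outlier oP hphi
  (outlier_inj oP out_regG in_regG) (outlier_automorphism oP out_regG in_regG).
case: (pickP (@predT (FIX phi))) => [x0 _|no_x]; last by apply/Or41/eq_card0.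
have degE := automorphism_degree oP' o'_inj o'_auto.
pose d' := outdeg x0.
have in_reg (v : FIX phi) : \sum_u arc u v = d' by rewrite /d' outdegE -(degE x0 v).
have out_reg (u : FIX phi) : \sum_v arc u v = d' by rewrite -(in_reg x0) -(degE u).
have cardF := card_outlier oP' out_reg x0.
(* As [phi] moves a vertex, the fixed subdigraph has smaller order, and the Moore bound is monotone
   in the degree. *)
have d'_lt : d' < d.
  have : #|FIX phi| < #|G|.
    rewrite card_sig -cardsT; apply: proper_card; rewrite properT.
    apply/eqP => /setP fixT; apply: hphi1; apply/permP => x.
    by have := fixT x; rewrite !inE perm1 => /eqP.
  rewrite cardF (card_outlier oP out_regG (val x0)) ltn_add2r.
  by rewrite !ltnNge; apply: contra; apply: leq_moore.
case: (ltngtP d' 1) => [d'0|d'2|d'1].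
- apply: Or42; have d'E : d' = 0 by lia.
  (* Only the term 0^0 = 1 of the Moore sum survives, so the order is 2. *)
  split; first by rewrite cardF d'E /moore big_ord_recl big1 // => i _; rewrite exp0n.
  by move=> x y; have /eqP := out_reg x; rewrite d'E sum_nat_eq0 => /forallP/(_ y); rewrite eqb0.
- apply: Or44; exists d'; split.
    suff : d' != 2 by lia.
    by apply/eqP => d'E; rewrite d'E in out_reg; apply: (no_degree_two oP' hk out_reg x0).
  case: hG => geo _ _; split=> //; first exact: induced_geodetic.
  split; first by exists x0.
  by move=> u; rewrite outdegE out_reg.
- apply: Or43; rewrite d'1 in out_reg in_reg.
  exact: (degree_one_dicycle oP' out_reg in_reg x0 (ltnW hk)).
Qed.
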